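(* The inequality $$\#\mathcal N_r(x)\ge\frac{x}{3}\,(1+o(1))$$ holds as $x\to\infty$.
   Context: $\varphi$ denotes the Euler function. For an odd prime $p$, put $f_r(p)=(p-1)/2-\varphi(p-1)$. For real $x\ge 1$, $\mathcal N_r(x)=\{1\le m\le x: m\ne f_r(p)\text{ for every odd prime } p\}$, where $m$ ranges over integers (the Robbins numbers up to $x$). *)

(* Defs.v *)
From HB Require Import structures.
From mathcomp Require Import all_boot all_order all_algebra finmap.
From mathcomp Require Import all_classical all_reals all_analysis.

Set Implicit Arguments.
Unset Strict Implicit.
Unset Printing Implicit Defensive.

Import Order.TTheory GRing.Theory Num.Theory.
Import numFieldNormedType.Exports.

Local Open Scope classical_set_scope.
Local Open Scope ring_scope.

(* Used only for odd p, where the halving p.-1./2 is exact. *)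
Definition f_r (p : nat) : int := (p.-1./2)%:Z - (totient p.-1)%:Z.

Definition N_r (R : realType) (x : R) : set int :=
  [set m : int | [/\ 1 <= m, m%:~R <= x &
                   forall p : nat, prime p -> odd p -> m <> f_r p]].

(* [fset_set] sends infinite sets to the empty one; see [finite_N_r]. *)
Definition card_N_r (R : realType) (x : R) : nat := #|` fset_set (N_r x) |%fset.

Lemma finite_N_r (R : realType) (x : R) : finite_set (N_r x).
Proof.
apply: (@sub_finite_set _ _ (Posz @` `I_(Num.truncn x).+1)); last first.
  exact/finite_image/finite_II.
move=> m [m1 mx _]; case: m m1 mx => // n _ mx; exists n => //=.
by rewrite ltnS truncn_ge_nat // (le_trans _ mx) // ler0n.
Qed.

(* Main.v *)
Require Import Defs.
From HB Require Import structures.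
From mathcomp Require Import all_boot all_order all_algebra finmap.
From mathcomp Require Import all_classical all_reals all_analysis.
From mathcomp Require Import zify ring lra.

(** Put p = 2h+1 and h = 2^b k with k odd, so that
    f_r(p) = h - phi(2h) = 2^b (k - phi(k)).

    The integers m with either v_2(m) even and m = 0 modulo 3, or v_2(m) odd and
    m = 1 modulo 3, have density 2/9 + 1/9 = 1/3 ([count_mod3_class]). It is enough
    that almost none of them is a value of f_r ([unrepresented_count]).

    The reason is a congruence modulo 3 ([class_structure]). If m = f_r(p) belongs
    to this class, then the primality of 2h+1 forces 3 | h, or r^2 | h for some odd
    prime r: for k squarefree and prime to 3, phi(k) is 0 or 1 modulo 3, and then
    either 3 | 2h+1 or m is outside the class.

    It remains to see that these exceptional h produce o(N) values m <= N
    ([represented_count]). Although h may be as large as N^2, the least odd prime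
    factor q of h satisfies h/q <= m <= N ([leq_mul_robbins_value]). Fix a large P.
    When q <= P, the prime p is at most 2PN+1, and the primes have density 0. When
    q > P, a square r^2 with r >= q divides h. If r = q, then h/q determines h and has
    no odd prime factor up to P; such integers have small density since phi(M)/M
    can be made small for M odd ([odd_small_totient]). If r > q, then there are at
    most pi(r) choices of q and N/r^2 choices of the cofactor, and the sum of
    pi(r)/r^2 over primes r > P is a convergent tail by Chebyshev's bound
    ([prime_square_sum_tail]). *)

Set Implicit Arguments.
Unset Strict Implicit.
Unset Printing Implicit Defensive.

(** * Chebyshev's bound *)

Definition primes_upto n : seq nat := [seq p <- iota 0 n.+1 | prime p].
Definition prime_pi n := size (primes_upto n).

Lemma mem_primes_upto n p : (p \in primes_upto n) = prime p && (p <= n).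
Proof. by rewrite mem_filter mem_iota ltnS. Qed.

Lemma uniq_primes_upto n : uniq (primes_upto n).
Proof. exact/filter_uniq/iota_uniq. Qed.

Lemma leq_prime_pi m n : m <= n -> prime_pi m <= prime_pi n.
Proof.
move=> mn; apply: uniq_leq_size (uniq_primes_upto m) _ => p.
by rewrite !mem_primes_upto => /andP[-> /leq_trans]; apply.
Qed.

Lemma dvdn_prod_primes (s : seq nat) m :
  uniq s -> all prime s -> all (dvdn^~ m) s -> \prod_(p <- s) p %| m.
Proof.
elim: s => [|p s IH] /=; first by rewrite big_nil dvd1n.
case/andP=> ps us /andP[pp prs] /andP[pm sm].
rewrite big_cons Gauss_dvd ?pm ?IH//.
rewrite big_seq; elim/big_ind: _ => [|x y cx cy|q qs]; first exact: coprimen1.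
  by rewrite coprimeMr cx.
rewrite prime_coprime// dvdn_prime2 ?(allP prs q)//.
by apply: contraNneq ps => ->.
Qed.

Lemma prime_dvd_fact p n : prime p -> (p %| n`!) = (p <= n).
Proof.
move=> pp; apply/idP/idP => [|pn]; last by rewrite dvdn_fact // prime_gt0.
elim: n => [|n IH]; first by rewrite dvdn1; case: p pp => [|[]].
rewrite factS Euclid_dvdM // => /orP[/dvdn_leq -> //|/IH]; exact: leqW.
Qed.

Lemma leq_central_bin n : 'C(n.*2, n) <= 2 ^ n.*2.
Proof.
rewrite -[2]/(1 + 1) expnDn.
rewrite (bigD1 (inord n : 'I_n.*2.+1)) //= inordK; last by lia.
by rewrite !exp1n !muln1 leq_addr.
Qed.

(** The primes of the interval (n, 2n] all divide 'C(2n, n) <= 4^n, and each of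
    them exceeds n = 2^j, so their number s satisfies n^s <= 4^n. *)
Lemma primes_in_dyadic_block j :
  j * size [seq p <- primes_upto (2 ^ j.+1) | 2 ^ j < p] <= 2 ^ j.+1.
Proof.
set s := [seq p <- _ | _]; set n := 2 ^ j.
have En : 2 ^ j.+1 = n.*2 by rewrite expnS mul2n.
have sP p : p \in s -> [/\ prime p, n < p & p <= n.*2].
  by rewrite mem_filter mem_primes_upto En => /and3P[].
have us : uniq s by exact/filter_uniq/uniq_primes_upto.
have sdiv : \prod_(p <- s) p %| 'C(n.*2, n).
  apply: dvdn_prod_primes => //; apply/allP => p /sP[] // pp np pn.
  have nn : n <= n.*2 by rewrite -addnn leq_addr.
  have : p %| (n.*2)`! by apply: dvdn_fact; rewrite prime_gt0.
  rewrite -(bin_fact nn) -{2}addnn addnK.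
  rewrite Euclid_dvdM// => /orP[//|].
  by rewrite Euclid_dvdM// orbb prime_dvd_fact// leqNgt np.
have : n ^ size s <= 2 ^ n.*2.
  apply: leq_trans (leq_central_bin n); apply: leq_trans (dvdn_leq _ sdiv).
    rewrite big_seq -(size_map id) map_id => {sdiv us}.
    elim: s sP => [|p s IH] sP; first by rewrite big_nil.
    rewrite -big_seq big_cons /= expnS leq_mul //.
      by case: (sP p (mem_head _ _)) => _ /ltnW.
    by rewrite big_seq IH // => q qs; apply: sP; rewrite inE qs orbT.
  by rewrite bin_gt0; lia.
by rewrite /n -expnM leq_exp2l// -/n -En.
Qed.

(** Chebyshev's upper bound, at powers of two only: an induction that adds one
    dyadic block at a time, which is all that the later sums need. *)
Lemma chebyshev_pow2 j : j * prime_pi (2 ^ j) <= 4 * 2 ^ j.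
Proof.
elim: j => [//|j IH].
case: (leqP j 2) => [j2|j3].
  (* The constant 4 is preserved by the inductive step only once j >= 3. *)
  by case: j j2 {IH} => [|[|[|]]].
have /= := primes_in_dyadic_block j.
set s := [seq p <- _ | _] => bl.
have cut : prime_pi (2 ^ j.+1) <= prime_pi (2 ^ j) + size s.
  rewrite -size_cat; apply: uniq_leq_size (uniq_primes_upto _) _ => p.
  rewrite mem_cat !mem_primes_upto => /andP[pp pj].
  by rewrite [p \in s]mem_filter mem_primes_upto pp pj andbT leqNgt; case: ltnP.
move: bl cut IH; move: (size s) => c; clear s.
rewrite !expnS; move: (2 ^ j) (prime_pi _) (prime_pi _) => X a b H1 H2 H3.
have : j * b <= j * a + j * c by rewrite -mulnDr leq_mul2l H2 orbT.
nia.
Qed.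

Lemma prime_pi_littleo k : exists n0, forall n, n0 <= n -> k * prime_pi n <= n.
Proof.
exists (2 ^ (8 * k)) => n n0.
have n_gt0 : 0 < n by apply: leq_trans n0; rewrite expn_gt0.
have /andP[lo /ltnW hi] := trunc_log_bounds (isT : 1 < 2) n_gt0.
move: (trunc_log _ _) lo hi (trunc_log_max (isT : 1 < 2) n0) => j lo hi kj.
have := chebyshev_pow2 j.+1; have := leq_prime_pi hi.
move: (prime_pi _) (prime_pi _) => b a ab; rewrite expnS => H.
have H2 : j.+1 * a <= 8 * n.
  by apply: leq_trans (_ : j.+1 * b <= _); [rewrite leq_mul2l ab orbT | lia].
rewrite -(leq_pmul2l (isT : 0 < 8)); apply: leq_trans H2.
by rewrite mulnA leq_mul2r; apply/orP; right; lia.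
Qed.

(** The number of triples (q, r, t) with q <= r primes, a < r <= b, t > 0 and
    r^2 t <= N. *)
Definition prime_square_sum a b N :=
  \sum_(a.+1 <= r < b.+1 | prime r) prime_pi r * (N %/ r ^ 2).

(** Each of the at most pi(2^(J+1)) terms of the block is at most
    pi(2^(J+1)) N / 4^J, and Chebyshev bounds pi(2^(J+1)) by 8 * 2^J / (J+1). *)
Lemma prime_square_block J N :
  J.+1 ^ 2 * prime_square_sum (2 ^ J) (2 ^ J.+1) N <= 64 * N.
Proof.
have le1 : prime_square_sum (2 ^ J) (2 ^ J.+1) N <=
    prime_pi (2 ^ J.+1) * (prime_pi (2 ^ J.+1) * (N %/ (2 ^ J) ^ 2)).
  rewrite {2}/prime_pi /primes_upto size_filter -sum1_count big_distrl.
  rewrite -[X in iota 0 X]subn0 -/(index_iota 0 _)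
    (@big_cat_nat _ _ _ (2 ^ J).+1 0)//=; last first.
    by rewrite ltnS leq_exp2l.
  rewrite mulnDr; apply: leq_trans (leq_addl _ _); rewrite big_distrr.
  rewrite /prime_square_sum big_nat_cond [in leqRHS]big_nat_cond.
  apply: leq_sum => r /andP[/andP[r1 r2] pr]; rewrite mul1n.
  apply: leq_mul; first by rewrite leq_prime_pi.
  by apply: leq_div2l; rewrite ?expn_gt0 ?leq_exp2r ?expn_gt0 // ltnW.
have := chebyshev_pow2 J.+1; move: le1; rewrite expnS => le1 ch.
have := leq_divM N ((2 ^ J) ^ 2).
move: le1 ch; move: (prime_square_sum _ _ _) (prime_pi _) => S c.
rewrite -!mulnn; move: (N %/ _) => d; move: (2 ^ J) => X le1 ch le3.
have le4 : J.+1 * c * (J.+1 * c) <= 8 * X * (8 * X) by apply: leq_mul; lia.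
apply: leq_trans (_ : (J.+1 * c * (J.+1 * c)) * d <= _).
  by rewrite (_ : _ * d = J.+1 * J.+1 * (c * (c * d))) ?leq_mul2l ?le1 ?orbT//; lia.
apply: leq_trans (leq_mul le4 (leqnn d)) _.
by rewrite (_ : _ * d = 64 * (d * (X * X))) ?leq_mul2l ?le3//; lia.
Qed.

(** The blocks contribute at most 64 N / (i+1)^2 for i >= J, a convergent series
    whose tail is at most 64 N / J. The trivial bound pi(r) <= r would
    not do: the sum of 1/r over primes diverges. The induction peels off the first
    block, so that J moves and no division is needed. *)
Lemma prime_square_sum_tail K J N :
  J * prime_square_sum (2 ^ J) (2 ^ (J + K)) N <= 64 * N.
Proof.
elim: K J => [|K IH] J.
  by rewrite addn0 /prime_square_sum big_geq// muln0.
have -> : prime_square_sum (2 ^ J) (2 ^ (J + K.+1)) N =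
    prime_square_sum (2 ^ J) (2 ^ J.+1) N +
    prime_square_sum (2 ^ J.+1) (2 ^ (J.+1 + K)) N.
  rewrite addSnnS /prime_square_sum (@big_cat_nat _ _ _ (2 ^ J.+1).+1)//=;
    by rewrite ltnS leq_exp2l//; lia.
move: (IH J.+1) (prime_square_block J N); rewrite -mulnn.
move: (prime_square_sum _ _ _) (prime_square_sum _ _ _) => a b Ha Hb.
rewrite -(leq_pmul2l (ltn0Sn J)).
by nia.
Qed.

(** * Integers without small odd prime factors *)

Lemma size_coprime_iota M c :
  size [seq b <- iota 0 (c * M) | coprime M b] = c * totient M.
Proof.
elim: c => [//|c IH].
rewrite mulSnr iotaD filter_cat size_cat IH mulSnr add0n; congr (_ + _).
rewrite -[X in iota X]addn0 iotaDl filter_map size_map size_filter.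
rewrite totient_count_coprime -sum1_count big_mkcond.
rewrite -[X in iota 0 X]subn0 -/(index_iota 0 M); apply: eq_bigr => i _ /=.
by rewrite /coprime gcdnMDl; case: eqP.
Qed.

Definition odd_prod n := \prod_(i < n) i.*2.+1.

Lemma odd_odd_prod n : odd (odd_prod n).
Proof.
rewrite /odd_prod; elim/big_ind: _ => [//|x y ox oy|i _].
  by rewrite oddM ox.
by rewrite /= odd_double.
Qed.

Lemma dvdn_odd_prod n i : i < n -> i.*2.+1 %| odd_prod n.
Proof. by move=> lt_in; rewrite /odd_prod (bigD1 (Ordinal lt_in)) //= dvdn_mulr. Qed.

(** With M the product, the integers a * b with a = 2i+1 (a divisor of M) and b
    prime to M, b < M^2 / a, are pairwise distinct and lie below M^2: the factor a
    is recovered as the part of a * b made of primes of M. Counting them gives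
    phi(M)/M * (sum of the 1/(2i+1)) <= 1. *)
Lemma totient_odd_prod n :
  totient (odd_prod n) * \sum_(i < n) odd_prod n %/ i.*2.+1 <= odd_prod n ^ 2.
Proof.
set M := odd_prod n.
have M_gt0 : 0 < M by rewrite odd_gt0 // odd_odd_prod.
pose L i := [seq i.*2.+1 * b | b <- [seq b <- iota 0 (M %/ i.*2.+1 * M) | coprime M b]].
pose s := flatten [seq L i | i <- iota 0 n].
have szs : size s = totient M * \sum_(i < n) M %/ i.*2.+1.
  rewrite size_flatten /shape -map_comp sumnE big_map big_distrr /=.
  rewrite -[X in iota 0 X]subn0 -/(index_iota 0 n) big_mkord.
  by apply: eq_bigr => i _; rewrite size_map size_coprime_iota mulnC.
have us : uniq s.
  apply/allpairs_uniq_dep => //; first exact: iota_uniq.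
    by move=> i _; apply/filter_uniq/iota_uniq.
  (* a * b = a' * b' with b' prime to M makes a divide a'. *)
  have aux i i' b b' : i < n -> coprime M b' ->
      i.*2.+1 * b = i'.*2.+1 * b' -> i.*2.+1 %| i'.*2.+1.
    move=> lt_in cb' E; rewrite -(@Gauss_dvdl _ _ b') -?E ?dvdn_mulr //.
    exact: coprime_dvdl (dvdn_odd_prod lt_in) cb'.
  move=> _ _ /allpairsPdep[i [b [ii ib ->]]] /allpairsPdep[i' [b' [ii' ib' ->]]] /=.
  move: ii ii'; rewrite !mem_iota !add0n => /andP[_ ii] /andP[_ ii'].
  move: ib ib'; rewrite !mem_filter => /andP[cb _] /andP[cb' _] E.
  have /eqP[] : i.*2.+1 == i'.*2.+1.
    by rewrite eqn_dvd (aux _ _ _ _ ii cb' E) (aux _ _ _ _ ii' cb (esym E)).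
  move=> /double_inj Ei; rewrite -Ei in E *; congr (existT _ _ _).
  by move/eqP: E; rewrite eqn_pmul2l // => /eqP.
rewrite -szs -(size_iota 0 (M ^ 2)); apply: uniq_leq_size us _ => t.
case/flatten_mapP => i; rewrite mem_iota => /andP[_]; rewrite add0n => lt_in /mapP[b].
rewrite mem_filter mem_iota => /and3P[_ _ ltb] ->.
have dM : i.*2.+1 %| M := dvdn_odd_prod lt_in.
rewrite mem_iota /= add0n -mulnn.
rewrite (_ : M * M = i.*2.+1 * (M %/ i.*2.+1 * M)) ?ltn_pmul2l //.
by rewrite mulnA [_ * (M %/ _)]mulnC divnK.
Qed.

(** The sum of the 1/(2i+1) diverges: every dyadic block of indices contributes at
    least 1/4. Taking M divisible by all the 2i+1 keeps the terms integral. *)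
Lemma sum_inv_odd J M : (forall i, i < 2 ^ J -> i.*2.+1 %| M) ->
  J * M <= 4 * \sum_(i < 2 ^ J) M %/ i.*2.+1.
Proof.
rewrite -(big_mkord xpredT (fun i => M %/ i.*2.+1)).
elim: J => [//|J IH] dvdM.
rewrite (@big_cat_nat _ _ _ (2 ^ J)) ?leq_exp2l //= mulSn addnC mulnDr.
apply: leq_add; first by apply: IH => i iJ; apply/dvdM/(leq_trans iJ); rewrite leq_exp2l.
rewrite -(@leq_pmul2l (2 ^ J)) ?expn_gt0 // mulnA big_distrr /=.
have {1}-> : 2 ^ J = 2 ^ J.+1 - 2 ^ J by rewrite expnS mul2n -addnn addnK.
rewrite -sum_nat_const_nat !big_seq; apply: leq_sum => i.
rewrite mem_index_iota => /andP[_ iJ].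
rewrite -{1}(divnK (dvdM i iJ)) mulnC leq_mul2r; apply/orP; right.
by move: iJ; rewrite expnS; lia.
Qed.

(** phi(M)/M takes arbitrarily small values, even on odd M; equivalently the
    integers with no small odd prime factor have arbitrarily small density. *)
Lemma odd_small_totient k : exists M, odd M /\ k * totient M <= M.
Proof.
pose n := 2 ^ (4 * k); exists (odd_prod n); split; first exact: odd_odd_prod.
have /sum_inv_odd : forall i, i < 2 ^ (4 * k) -> i.*2.+1 %| odd_prod n.
  exact: dvdn_odd_prod.
have := totient_odd_prod n.
have : 0 < odd_prod n by rewrite odd_gt0 // odd_odd_prod.
rewrite -mulnn -/n; move: (\sum_(i < _) _) => S.
move: (totient _) => t; move: (odd_prod n) => M M0 H1.
rewrite -mulnA leq_pmul2l // => H2; rewrite -(leq_pmul2r M0).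
by apply: leq_trans H1; rewrite mulnAC mulnC leq_mul2l H2 orbT.
Qed.

(** * The density of the residue classes *)

Lemma sum_even_odd (F : nat -> nat) n :
  \sum_(m < n) F m = \sum_(k < uphalf n) F k.*2 + \sum_(k < n./2) F k.*2.+1.
Proof.
elim: n => [|n IH]; first by rewrite !big_ord0.
rewrite big_ord_recr IH /= uphalf_half.
have [on|en] := boolP (odd n); rewrite /= ?add1n ?add0n.
  rewrite [X in _ = _ + X]big_ord_recr /= addnA; congr (_ + F _).
  by rewrite -[LHS]odd_double_half on.
rewrite [X in _ = X + _]big_ord_recr /= addnAC; congr (_ + F _ + _).
by rewrite -[LHS]odd_double_half (negPf en).
Qed.

Lemma count_residue3 c n : c < 3 -> n <= 3 * (\sum_(k < n) (k %% 3 == c)) + 2.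
Proof.
move=> c3; suff H : (n + 2 - c) %/ 3 <= \sum_(k < n) (k %% 3 == c) by lia.
elim: n => [|n IH]; first by rewrite big_ord0; lia.
by rewrite big_ord_recr /=; move: (\sum_(i < n) _) IH => S IH; case: eqP; lia.
Qed.

(** The residue modulo 3 is prescribed according to the parity of the 2-adic
    valuation. The class with i = 0 and j = 1 is the one whose members are almost
    never represented; the other residues enter because halving an even member
    exchanges the two parities and multiplies both residues by 2. *)
Definition mod3_class i j m := (0 < m) && (m %% 3 == if odd (logn 2 m) then j else i).

(** Every such class has density 1/3: its odd members number about N/6, and its
    even members are the doubles of the members up to N/2 of a class of the same
    kind. Each halving costs a bounded error, hence the logarithm. *)
Lemma count_mod3_class N i j : i < 3 -> j < 3 ->
  N <= 3 * (\sum_(m < N.+1) mod3_class i j m) + 3 * (trunc_log 2 N).+1.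
Proof.
elim/ltn_ind: N i j => N IH i j i3 j3.
case: (leqP N 1) => [|N1]; first by lia.
have halfN : N./2 < N by lia.
have mod3 k : k %% 3 < 3 by rewrite ltn_pmod.
have := IH N./2 halfN _ _ (mod3 (2 * j)) (mod3 (2 * i)).
rewrite (sum_even_odd (fun m => mod3_class i j m : nat)) (trunc_log2S N1).
have : \sum_(m < N./2.+1) mod3_class ((2 * j) %% 3) ((2 * i) %% 3) m <=
    \sum_(k < N./2.+1) mod3_class i j k.*2.
  apply: leq_sum => k _; rewrite /mod3_class double_gt0.
  case: (posnP k) => //= k0; rewrite -mul2n lognM // (_ : logn 2 2 = 1) // add1n /=.
  by case: (odd _) => /=; do 2!case: eqP => //=; lia.
have : \sum_(k < uphalf N) (k %% 3 == (2 * i + 1) %% 3) <=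
    \sum_(k < uphalf N) mod3_class i j k.*2.+1.
  apply: leq_sum => k _; rewrite /mod3_class lognE dvdn2 /= odd_double /=.
  by do 2!case: eqP => //=; lia.
have := count_residue3 (uphalf N) (mod3 (2 * i + 1)).
move=> /=; do 4!move: (\sum_(_ < _) _) => ?; lia.
Qed.

(** * The congruence modulo 3 *)

(** The value of f_r at the prime 2h+1. *)
Definition robbins_value h := h - totient (2 * h).
Definition odd_pdiv h := pdiv h`_2^'.

Lemma odd_part_decomposition h : 0 < h -> exists b k, odd k /\ h = 2 ^ b * k.
Proof.
move=> h0; exists (logn 2 h), h`_2^'; split; last by rewrite -p_part partnC.
by rewrite odd_2'nat part_pnat.
Qed.

Lemma totient_leq n : totient n <= n.
Proof.
rewrite totient_count_coprime -[leqRHS]subn0 -[leqRHS]muln1 -sum_nat_const_nat.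
by apply: leq_sum => i _; exact: leq_b1.
Qed.

Lemma totient_dyadic b k : odd k -> totient (2 * (2 ^ b * k)) = 2 ^ b * totient k.
Proof.
move=> ok; rewrite mulnA -expnS totient_coprime ?totient_pfactor ?mul1n //.
by rewrite coprimeXl // coprime2n.
Qed.

Lemma totient_dvd_bound q k : prime q -> q %| k -> q * totient k <= q.-1 * k.
Proof.
move=> pq; case: (posnP k) => [->|k0 qk]; first by rewrite (_ : totient 0 = 0) ?muln0.
have [k' cqk' Ek] := pfactor_coprime pq k0.
have e0 : 0 < logn q k by rewrite logn_gt0 mem_primes pq k0.
move: (logn q k) e0 Ek => e e0 Ek; rewrite Ek.
rewrite totient_coprime; last by rewrite coprime_sym coprimeXl.
rewrite totient_pfactor // -[in leqRHS](prednK e0) expnS.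
have := totient_leq k'; move: (totient k') => t; move: (q ^ _) => x tk.
rewrite [k' * _]mulnCA [q.-1 * (q * _)]mulnCA [k' * x]mulnC [q.-1 * (x * _)]mulnA.
by rewrite leq_mul2l [t * _]mulnC leq_mul2l tk !orbT.
Qed.

Lemma totient_even k : odd k -> 1 < k -> ~~ odd (totient k).
Proof.
move=> ok k1; have pq := pdiv_prime k1; set q := pdiv k in pq.
have [k' cqk' Ek] := pfactor_coprime pq (ltnW k1).
have e0 : 0 < logn q k by rewrite logn_gt0 mem_primes pq (ltnW k1) pdiv_dvd.
have oq : odd q by apply: dvdn_odd ok; apply: pdiv_dvd.
rewrite Ek totient_coprime; last by rewrite coprime_sym coprimeXl.
rewrite totient_pfactor // !oddM -subn1 oddB ?prime_gt0 // oq /=.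
by rewrite andbF.
Qed.

(** For k squarefree, phi(k) is the product of the r - 1 over the primes r dividing
    k, and r - 1 is 0 or 1 modulo 3 as r is not 3. *)
Lemma totient_squarefree_mod3 k : 0 < k -> ~~ (3 %| k) ->
  (forall r, prime r -> ~~ (r ^ 2 %| k)) -> totient k %% 3 != 2.
Proof.
elim/ltn_ind: k => k IH k0 k3 sf.
case: (leqP k 1) => [|k1]; first by case: k k0 {IH k3 sf} => [|[|]].
have pq := pdiv_prime k1; set q := pdiv k in pq.
have /dvdnP[k' Ek] : q %| k by exact: pdiv_dvd.
have cqk' : coprime k' q.
  rewrite coprime_sym prime_coprime //; apply: contra (sf q pq) => qk'.
  by rewrite Ek -mulnn dvdn_pmul2r ?prime_gt0.
have k'0 : 0 < k' by case: k' Ek {cqk'} k0 => [->|].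
have dk' : k' %| k by rewrite Ek dvdn_mulr.
have := IH k' _ k'0 _ _.
rewrite [in totient k]Ek totient_coprime // (totient_prime pq) // => H.
have {H} H : totient k' %% 3 != 2.
  apply: H; first by rewrite Ek ltn_Pmulr ?prime_gt1.
    by apply: contra k3 => /dvdn_trans; apply.
  by move=> r pr; apply: contra (sf r pr) => /dvdn_trans; apply.
have : q %% 3 != 0 by apply: contra k3 => q3; rewrite Ek dvdn_mull.
have := prime_gt0 pq; move: (totient k') H => t Ht q0 q3; rewrite -modnMm.
have : q.-1 %% 3 = 0 \/ q.-1 %% 3 = 1 by lia.
have : t %% 3 = 0 \/ t %% 3 = 1 by lia.
by case=> -> [] ->.
Qed.

(** The factor (q - 1)/q in the totient keeps h - phi(2h) at least h/q, which
    bounds h in terms of the represented value. *)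
Lemma leq_mul_robbins_value q h : prime q -> odd q -> q %| h -> h <= q * robbins_value h.
Proof.
move=> pq oq qh; case: (posnP h) => [->//|h0].
have [b [k [ok Eh]]] := odd_part_decomposition h0.
have qk : q %| k.
  move: qh; rewrite Eh Gauss_dvdr // coprime_sym coprimeXl //.
  by rewrite coprime2n.
rewrite /robbins_value mulnBr Eh totient_dyadic //.
have := totient_dvd_bound pq qk; have := prime_gt0 pq.
rewrite leq_subRL; last first.
  rewrite mulnCA [q * (_ * _)]mulnCA leq_mul2l leq_mul2l totient_leq.
  by rewrite !orbT.
move: (2 ^ b) (totient k) => x t q0 H.
have : x * (q * t) <= x * (q.-1 * k) by rewrite leq_mul2l H orbT.
case: q q0 {pq oq qk H} qh => // q _ _ /=; lia.
Qed.

Lemma expn2_mod3 b : 2 ^ b %% 3 = if odd b then 2 else 1.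
Proof. by elim: b => // b IH; rewrite expnS -modnMmr IH /=; case: (odd b). Qed.

(** Write h = 2^b k with k odd, and suppose that 3 does not divide h and that k is
    squarefree. Since 2h+1 is a prime other than 3, h = 2 modulo 3. The value
    m = 2^b (k - phi(k)) has 2-adic valuation b, as phi(k) is even, and
    m = 2 - 2^b phi(k) modulo 3 with phi(k) = 0 or 1 modulo 3. So m is 2, or else
    1 for b even and 0 for b odd: m is outside the class in all cases. *)
Lemma class_structure h : prime (2 * h + 1) -> mod3_class 0 1 (robbins_value h) ->
  3 %| h \/ exists r, [/\ prime r, odd r & r ^ 2 %| h].
Proof.
move=> pp /andP[m0 cm].
case: (boolP (3 %| h)) => [|h3]; [by left | right].
have h0 : 0 < h by case: h m0 {cm h3 pp}.
have [b [k [ok Eh]]] := odd_part_decomposition h0.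
case: (boolP (all (fun r => ~~ (r ^ 2 %| k)) (primes k))) => [/allP sf|]; last first.
  case/allPn => r; rewrite mem_primes negbK => /and3P[pr _ rk] r2.
  by exists r; split; rewrite ?(dvdn_odd rk) // Eh dvdn_mull.
have k0 : 0 < k by rewrite odd_gt0.
have k3 : ~~ (3 %| k) by apply: contra h3; rewrite Eh; apply: dvdn_mull.
have {}sf r : prime r -> ~~ (r ^ 2 %| k).
  move=> pr; apply/negP => r2; have /sf : r \in primes k.
    by rewrite mem_primes pr k0 (dvdn_trans _ r2) // dvdn_mulr.
  by rewrite r2.
have t3 := totient_squarefree_mod3 k0 k3 sf.
have Em : robbins_value h = 2 ^ b * (k - totient k).
  by rewrite /robbins_value Eh totient_dyadic // mulnBr.
have k1 : 1 < k.
  by rewrite ltnNge; apply/negP => k1; move: m0; rewrite Em (_ : k = 1) ?muln0 //; lia.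
have te := totient_even ok k1.
have ob : logn 2 (robbins_value h) = b.
  rewrite Em lognM ?expn_gt0 ?pfactorK //; last first.
    by move: m0; rewrite Em muln_gt0 => /andP[].
  rewrite [X in _ + X]lognE dvdn2 oddB ?totient_leq // ok (negPf te) /=.
  by rewrite andbF addn0.
have hm : h %% 3 = 2.
  have : ~~ (3 %| 2 * h + 1).
    rewrite dvdn_prime2 //; apply/eqP => E3.
    have h1 : h = 1 by lia.
    by move: m0; rewrite h1.
  lia.
have Eq : robbins_value h + 2 ^ b * totient k = h.
  by rewrite Em -mulnDr subnK ?totient_leq.
move: cm; rewrite ob => cm.
have := hm; rewrite -Eq -modnDm -modnMm (eqP cm) expn2_mod3.
have : totient k %% 3 = 0 \/ totient k %% 3 = 1 by lia.
by case: (odd b) => -[] ->.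
Qed.

(** * Counting the represented members of the class *)

Lemma dvdn_odd_part h r : 0 < h -> odd r -> r %| h -> r %| h`_2^'.
Proof.
move=> h0 odr rh; rewrite -(@part_pnat_id (2^') r); first exact: partn_dvd.
by rewrite -odd_2'nat.
Qed.

Lemma odd_pdiv_prime h r :
  0 < h -> prime r -> odd r -> r %| h -> prime (odd_pdiv h).
Proof.
move=> h0 pr odr rh; apply/pdiv_prime/(leq_trans (prime_gt1 pr)).
by apply: dvdn_leq (dvdn_odd_part h0 odr rh); rewrite part_gt0.
Qed.

Lemma odd_odd_pdiv h : odd (odd_pdiv h).
Proof. by apply: dvdn_odd (pdiv_dvd _) _; rewrite odd_2'nat part_pnat. Qed.

Lemma odd_pdiv_dvd h : odd_pdiv h %| h.
Proof. exact: dvdn_trans (pdiv_dvd _) (dvdn_part _ _). Qed.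

Lemma odd_pdiv_min h r :
  0 < h -> prime r -> odd r -> r %| h -> odd_pdiv h <= r.
Proof.
by move=> h0 pr odr rh; apply: pdiv_min_dvd (prime_gt1 pr) (dvdn_odd_part h0 odr rh).
Qed.

Definition represented N m :=
  [/\ m <= N, mod3_class 0 1 m & exists2 h, prime (2 * h + 1) & m = robbins_value h].

(** Let m = robbins_value h be in the class and let q be the least odd prime factor
    of h, so that h <= q m. The three terms of the bound count three kinds of h.
    If q <= P, then 2h+1 is a prime up to 2PN+1. If q > P, then 3 does not divide
    h, so h has an odd prime square factor r^2. If r = q, then T = h/q <= N still
    has q as least odd prime factor, so T determines h, and T is prime to M because
    its odd prime factors exceed P >= M. If r > q, then h = q r^2 t with
    r^2 t = h/q <= N. *)
Lemma represented_count N P M J s : odd M -> 3 <= P -> M <= P -> 2 ^ J <= P ->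
  uniq s -> (forall m, m \in s -> represented N m) ->
  size s <= prime_pi (2 * P * N + 1) + ((N %/ M).+1 * totient M
            + prime_square_sum (2 ^ J) (2 ^ (J + N)) N).
Proof.
move=> oM P3 MP JP us sbad.
have M0 : 0 < M by rewrite odd_gt0.
pose L1 := [seq robbins_value p.-1./2 | p <- primes_upto (2 * P * N + 1)].
pose L2 := [seq robbins_value (T * odd_pdiv T) |
             T <- [seq T <- iota 0 ((N %/ M).+1 * M) | coprime M T]].
pose L3 := flatten [seq [seq robbins_value (q * (r ^ 2 * t)) |
               q <- primes_upto r, t <- iota 1 (N %/ r ^ 2)] |
             r <- [seq r <- index_iota (2 ^ J).+1 (2 ^ (J + N)).+1 | prime r]].
have sz1 : size L1 = prime_pi (2 * P * N + 1) by rewrite size_map.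
have sz2 : size L2 = (N %/ M).+1 * totient M by rewrite size_map size_coprime_iota.
have sz3 : size L3 = prime_square_sum (2 ^ J) (2 ^ (J + N)) N.
  rewrite size_flatten /shape -map_comp sumnE big_map big_filter.
  by apply: eq_bigr => r _; rewrite /= size_allpairs size_iota.
rewrite -sz1 -sz2 -sz3 -!size_cat; apply: uniq_leq_size us _ => m ms.
have [mN cm [h ph Em]] := sbad m ms.
rewrite Em in cm; have st := class_structure ph cm.
have h0 : 0 < h by case: (h) cm => [/andP[]|].
have [r [pr odr rh]] : exists r, [/\ prime r, odd r & r %| h].
  case: st => [h3|[r [pr odr r2]]]; first by exists 3.
  by exists r; split => //; apply: dvdn_trans r2; rewrite dvdn_exp.
have pq := odd_pdiv_prime h0 pr odr rh; have oq := odd_odd_pdiv h.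
have qh : odd_pdiv h %| h := odd_pdiv_dvd h.
have qmin r' := @odd_pdiv_min h r' h0.
move: (leq_mul_robbins_value pq oq qh); rewrite -Em => hqm.
rewrite !mem_cat; apply/or3P.
have [qP|Pq] := leqP (odd_pdiv h) P.
  constructor 1; apply/mapP; exists (2 * h + 1); last first.
    by rewrite Em; congr robbins_value; lia.
  rewrite mem_primes_upto ph leq_add2r -mulnA leq_mul2l /=.
  by apply: leq_trans hqm _; apply: leq_mul.
set q := odd_pdiv h in pq oq qh qmin hqm Pq.
case: st => [h3|[{pr odr rh} r' [pr odr r2]]].
  by have := qmin 3 isT isT h3; lia.
have rh : r' %| h by apply: dvdn_trans r2; rewrite dvdn_exp.
have qr := qmin r' pr odr rh.
have q0 := prime_gt0 pq.
case: (ltngtP q r') qr => // [qr _|Eq _]; last first.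
  rewrite -Eq in r2; move/dvdnP: qh => [T ET].
  have T0 : 0 < T by case: T ET h0 => [->|].
  have qT : q %| T by move: r2; rewrite ET -mulnn dvdn_pmul2r.
  have TN : T <= N.
    by apply: leq_trans mN; rewrite -(leq_pmul2l q0) mulnC -ET.
  have EqT : odd_pdiv T = q.
    apply/eqP; rewrite eqn_leq odd_pdiv_min //=.
    have Th : T %| h by rewrite ET dvdn_mulr.
    apply: qmin; [exact: odd_pdiv_prime T0 pq oq qT|exact: odd_odd_pdiv|].
    exact: dvdn_trans (odd_pdiv_dvd T) Th.
  constructor 2; apply/mapP; exists T; last by rewrite EqT -ET.
  rewrite mem_filter mem_iota /= add0n; apply/andP; split; last first.
    by apply: leq_ltn_trans TN _; rewrite ltn_ceil.
  rewrite /coprime; apply/negPn/negP => gn1.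
  have g1 : 1 < gcdn M T by have := gcdn_gt0 M T; rewrite M0; lia.
  set d := pdiv (gcdn M T).
  have dg : d %| gcdn M T by exact: pdiv_dvd.
  have dM : d %| M := dvdn_trans dg (dvdn_gcdl _ _).
  have dT : d %| T := dvdn_trans dg (dvdn_gcdr _ _).
  have dh : d %| h by rewrite ET dvdn_mulr.
  have qd := qmin d (pdiv_prime g1) (dvdn_odd dM oM) dh.
  by move: (leq_ltn_trans (leq_trans (dvdn_leq M0 dM) MP) Pq); rewrite ltnNge qd.
have cop : coprime q (r' ^ 2).
  rewrite coprimeXr // prime_coprime // dvdn_prime2 //.
  by rewrite neq_ltn qr.
have /dvdnP[t Et] : q * r' ^ 2 %| h by rewrite Gauss_dvd // qh r2.
have r20 : 0 < r' ^ 2 by rewrite expn_gt0 prime_gt0.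
have t0 : 0 < t by case: t Et h0 => [->|].
have E : h = q * (r' ^ 2 * t) by rewrite Et mulnC mulnA.
have tN : r' ^ 2 * t <= N.
  by apply: leq_trans mN; rewrite -(leq_pmul2l q0) -E.
constructor 3; apply/flatten_mapP; exists r'.
  rewrite mem_filter pr mem_index_iota ltnS /=; apply/andP; split.
    exact: leq_trans (leq_ltn_trans JP Pq) (ltnW qr).
  have r'N : r' <= N.
    by apply: leq_trans tN; rewrite -mulnn -mulnA leq_pmulr // muln_gt0 prime_gt0.
  apply: leq_trans r'N (leq_trans (ltnW (ltn_expl N (isT : 1 < 2))) _).
  by rewrite leq_exp2l // leq_addl.
apply/allpairsP; exists (q, t); split; rewrite /= -?E //.
  by rewrite mem_primes_upto pq ltnW.
by rewrite mem_iota t0 add1n ltnS leq_divRL // mulnC.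
Qed.

Lemma trunc_log_littleo c : exists n0, forall N, n0 <= N -> c * (trunc_log 2 N).+1 <= N.
Proof.
exists (2 ^ (4 * c)) => N n0.
have N_gt0 : 0 < N by apply: leq_trans n0; rewrite expn_gt0.
apply: leq_trans (trunc_logP (isT : 1 < 2) N_gt0).
have := trunc_log_max (isT : 1 < 2) n0; move: (trunc_log 2 N) => L cL.
apply: leq_trans (_ : 2 ^ (L./2 + L./2) <= _); last by rewrite leq_exp2l //; lia.
rewrite expnD; apply: leq_trans (_ : L./2.+1 * L./2.+1 <= _); last first.
  by apply: leq_mul; exact: ltn_expl.
apply: leq_trans (_ : c * (2 * L./2.+1) <= _).
  by rewrite leq_mul2l; apply/orP; right; lia.
by rewrite mulnA leq_mul2r; apply/orP; right; lia.
Qed.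

(** Each of the three terms of [represented_count] is O(N/k) for large N: the
    modulus M is chosen with phi(M) <= M/k, and J = 64k makes the tail sum at
    most N/k. The threshold P only has to dominate 3, M and 2^J, hence the sum of
    the three. *)
Lemma unrepresented_count k : exists n0, forall N, n0 <= N -> exists s : seq nat,
  [/\ uniq s,
      forall m, m \in s ->
        [/\ 0 < m, m <= N & forall h, prime (2 * h + 1) -> m <> robbins_value h]
    & k * N <= 3 * k * size s + 13 * N].
Proof.
have [M [oM kM]] := odd_small_totient k.
pose P := 3 + M + 2 ^ (64 * k).
have [n1 pi_small] := prime_pi_littleo (k * (2 * P + 1)).
have [n2 log_small] := trunc_log_littleo (3 * k).
exists (1 + n1 + n2 + k * totient M) => N n0N.
pose C := [seq m <- iota 0 N.+1 | mod3_class 0 1 m].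
pose isbad m := `[< represented N m >].
exists [seq m <- C | ~~ isbad m]; split.
- exact/filter_uniq/filter_uniq/iota_uniq.
- move=> m; rewrite !mem_filter mem_iota => /and3P[/asboolPn nb cm mN].
  split => [||h ph Em]; [by case/andP: cm|by rewrite add0n ltnS in mN|].
  by apply: nb; split=> //; exists h.
have szC : N <= 3 * size C + 3 * (trunc_log 2 N).+1.
  rewrite /C size_filter -sum1_count big_mkcond.
  rewrite -[X in iota _ X]subn0 -/(index_iota 0 _) big_mkord.
  apply: leq_trans (count_mod3_class N (isT : 0 < 3) (isT : 1 < 3)) _.
  by rewrite leq_add2r leq_mul2l /= leq_sum // => i _; case: mod3_class.
have szsplit : size C = size [seq m <- C | isbad m] + size [seq m <- C | ~~ isbad m].
  by rewrite -[in LHS](count_predC isbad) !size_filter.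
have szbad : size [seq m <- C | isbad m] <= prime_pi (2 * P * N + 1) +
    ((N %/ M).+1 * totient M + prime_square_sum (2 ^ (64 * k)) (2 ^ (64 * k + N)) N).
  have P3 : 3 <= P by rewrite /P -addnA leq_addr.
  have PM : M <= P by rewrite /P addnAC leq_addl.
  have PJ : 2 ^ (64 * k) <= P by rewrite leq_addl.
  apply: represented_count => //.
  - exact/filter_uniq/filter_uniq/iota_uniq.
  - by move=> m; rewrite mem_filter => /andP[/asboolP].
(* The primes up to 2PN+1 are thinned by the factor k(2P+1), as 2PN+1 <= (2P+1)N. *)
have bd1 : k * prime_pi (2 * P * N + 1) <= N.
  have P0 : 0 < 2 * P + 1 by rewrite addn1.
  rewrite -(leq_pmul2r P0) mulnAC; apply: leq_trans (pi_small _ _) _.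
    have : N <= 2 * P * N by rewrite leq_pmull.
    by lia.
  by rewrite mulnDr muln1 mulnC leq_add2l; lia.
have bd2 : k * ((N %/ M).+1 * totient M) <= 2 * N.
  rewrite mulnCA mulSn mul2n -addnn; apply: leq_add; first by lia.
  by apply: leq_trans (leq_divM N M); rewrite leq_mul2l kM orbT.
have bd3 : k * prime_square_sum (2 ^ (64 * k)) (2 ^ (64 * k + N)) N <= N.
  by have := prime_square_sum_tail N (64 * k) N; rewrite -mulnA leq_pmul2l.
have {}szbad : k * size [seq m <- C | isbad m] <= 4 * N.
  apply: leq_trans (leq_mul (leqnn k) szbad) _; rewrite (mulnDr k) (mulnDr k).
  by move: bd1 bd2 bd3; do 3!move: (k * _) => ?; lia.
have {}bdlog : 3 * k * (trunc_log 2 N).+1 <= N by apply: log_small; lia.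
move: szC szbad bdlog; rewrite szsplit; move: (size _) (size _) (trunc_log 2 N).+1.
clear => y x L szC /(leq_mul (leqnn 3)) szbad bdlog.
apply: leq_trans (leq_mul (leqnn k) szC) _; lia.
Qed.

(** * The real-variable statement *)

Import Order.TTheory GRing.Theory Num.Theory.
Import numFieldNormedType.Exports.

Local Open Scope classical_set_scope.
Local Open Scope ring_scope.

Lemma f_r_robbins_value (m p : nat) :
  (0 < m)%N -> prime p -> odd p -> m%:Z = f_r p ->
  exists2 h, prime (2 * h + 1)%N & m = robbins_value h.
Proof.
move=> m0 pp op; rewrite /f_r => E.
have Ep : p.-1 = (2 * p.-1./2)%N by have := prime_gt1 pp; lia.
exists p.-1./2; first by rewrite -Ep addn1 prednK ?prime_gt0.
by rewrite /robbins_value -Ep; lia.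
Qed.

Lemma size_le_card_N_r (R : realType) (x : R) (s : seq nat) : 0 <= x -> uniq s ->
  (forall m, m \in s -> [/\ (0 < m)%N, (m <= Num.truncn x)%N &
     forall h, prime (2 * h + 1)%N -> m <> robbins_value h]) ->
  (size s <= card_N_r x)%N.
Proof.
move=> x0 us sP; rewrite -(size_map Posz) /card_N_r.
apply: uniq_leq_size; first by rewrite map_inj_uniq // => a b [].
move=> _ /mapP[m /sP[m0 mx nr] ->].
rewrite in_fset_set; last exact: finite_N_r.
apply/mem_set; split; first by [].
  by rewrite -pmulrn -truncn_ge_nat.
by move=> p pp op E; have [h ph Em] := f_r_robbins_value m0 pp op E; exact: nr ph Em.
Qed.

Theorem theorem3 (R : realType) :
  exists2 g : R -> R, g x @[x --> +oo] --> (0 : R) &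
    \forall x \near +oo, x / 3 * (1 + g x) <= (card_N_r x)%:R.
Proof.
(* The cut at 0 is needed for g to tend to 0: only a lower bound for the density
   is known. *)
exists (fun x => Num.min 0 (3 * (card_N_r x)%:R / x - 1)); last first.
  near=> x.
  have x0 : 0 < x by near: x; exact: nbhs_pinfty_gt.
  have : Num.min 0 (3 * (card_N_r x)%:R / x - 1) <= 3 * (card_N_r x)%:R / x - 1.
    by rewrite ge_min lexx orbT.
  move=> gx; apply: le_trans (_ : x / 3 * (3 * (card_N_r x)%:R / x) <= _).
    by rewrite ler_pM2l ?divr_gt0 //; lra.
  by rewrite le_eqVlt; apply/orP; left; apply/eqP; field; rewrite gt_eqF.
apply/cvgr0Pnorm_le => eps eps0.
(* The error 13 N/k, plus x/k for the passage from x to N, is at most 14 x/k. *)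
have [k kpos keps] : exists2 k, (0 < k)%N & 14 <= k%:R * eps.
  exists (Num.truncn (14 / eps)).+1 => //.
  by rewrite -ler_pdivrMr //; apply/ltW/truncnS_gt.
have [n0 Hn] := unrepresented_count k.
near=> x.
have xn : (n0 + k + 1)%:R <= x by near: x; apply: nbhs_pinfty_ge; rewrite num_real.
have x0 : 0 < x by apply: lt_le_trans xn; rewrite ltr0n addn1.
have n0x : (n0 <= Num.truncn x)%N.
  rewrite truncn_ge_nat ?ltW //; apply: le_trans xn; rewrite ler_nat; lia.
have [s [us sP sz]] := Hn _ n0x.
have card := size_le_card_N_r (ltW x0) us sP.
have kN : (k * Num.truncn x <= 3 * k * card_N_r x + 13 * Num.truncn x)%N.
  by apply: leq_trans sz _; rewrite leq_add2r leq_mul2l card orbT.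
have kx : k%:R <= x by apply: le_trans xn; rewrite ler_nat; lia.
have key : k%:R * x <= 3 * k%:R * (card_N_r x)%:R + 14 * x.
  move: kN; rewrite -(ler_nat R) natrD !natrM.
  have /andP[] := truncn_itv (ltW x0); rewrite -natr1.
  move=> Nx /ltW /(ler_wpM2l (ler0n R k)); rewrite mulrDr mulr1.
  move: kx Nx; rewrite -!mulrA; move: (k%:R * _) (k%:R * _) (k%:R * _) => a b c *; lra.
have k0 : (0 : R) < k%:R by rewrite ltr0n.
rewrite ler_norml le_min ge_min (ltW eps0) /= oppr_le0 (ltW eps0) /= andbT.
rewrite lerBrDr ler_pdivlMr // -(ler_pM2l k0); nra.
Unshelve. all: by end_near.
Qed.
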